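(* Consider a collective choice problem with policy space $X=\mathbb R^d$, $d\ge 3$, in which each player $i\in\{1,\dots,n,A\}$ has Euclidean preferences $u_i(x)=-\tfrac12\|x-x_i^*\|^2$ with ideal point $x_i^*$. (a) If the profile $(x_i^* )_{i=1,\dots,n,A}$ satisfies Non-Coplanarity, then the collective choice problem is Manipulable. (b) The set of profiles $(x_i^* )_{i=1,\dots,n,A}\in\mathbb R^{d(n+1)}$ satisfying Non-Coplanarity has full Lebesgue measure and is open and dense in $\mathbb R^{d(n+1)}$.
   Context: There are $n$ voters ($n$ odd) and an agenda setter $A$. $x\succ_M y$ means a strict majority of voters strictly prefer $x$ to $y$. $x$ is Improvable if some $y$ satisfies $y\succ_A x$ and $y\succ_M x$; the problem is Manipulable if every policy other than the agenda setter's favorite ($x_A^*$) is Improvable. For $x\in\mathbb R^d$ and three distinct coordinates $a,b,c$, $[x]_{abc}=(x_a,x_b,x_c)\in\mathbb R^3$. The profile $(x_i^* )_{i=1,\dots,n,A}$ satisfies Non-Coplanarity if for every choice of three coordinates $a,b,c$, no four elements of $\{[x_1^*]_{abc},\dots,[x_n^*]_{abc},[x_A^*]_{abc}\}\subset\mathbb R^3$ are coplanar.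
   Formalization: Assumes n ≥ 3 (n odd): for n = 1 Non-Coplanarity is vacuous and (a) fails at x = x_1^* ≠ x_A^*. ''No four elements coplanar'' is read for any four distinct players, so coincident ideal points are not allowed. *)

(* Defs.v *)
From HB Require Import structures.
From mathcomp Require Import all_boot all_order all_algebra.
From mathcomp Require Import all_classical all_reals.
From mathcomp Require Import topology normedtype matrix_normedtype.
Set Implicit Arguments. Unset Strict Implicit. Unset Printing Implicit Defensive.
Import Order.TTheory GRing.Theory Num.Theory numFieldNormedType.Exports.
Local Open Scope ring_scope.
Local Open Scope classical_set_scope.

Section Defs.
Variable R : realType.

(* A profile with n voters and the agenda setter in R^d is a matrix
   P : 'M[R]_(n.+1, d); row i (i < n) is voter i's ideal point x_i^*,
   row ord_max (= n) is the agenda setter's ideal point x_A^*. *)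

Definition sqdist (d : nat) (x y : 'rV[R]_d) : R :=
  \sum_(j < d) (x 0 j - y 0 j) ^+ 2.

Definition eucl_util (d : nat) (xstar x : 'rV[R]_d) : R :=
  - (2%:R)^-1 * sqdist x xstar.

Definition voter_ideal (n d : nat) (P : 'M[R]_(n.+1, d)) (i : 'I_n) : 'rV[R]_d :=
  row (widen_ord (leqnSn n) i) P.

Definition setter_ideal (n d : nat) (P : 'M[R]_(n.+1, d)) : 'rV[R]_d :=
  row ord_max P.

Definition maj_pref (n d : nat) (P : 'M[R]_(n.+1, d)) (x y : 'rV[R]_d) : Prop :=
  (n < 2 * #|[set i : 'I_n | (eucl_util (voter_ideal P i) y <
                              eucl_util (voter_ideal P i) x)%R]|)%N.

Definition setter_pref (n d : nat) (P : 'M[R]_(n.+1, d)) (x y : 'rV[R]_d) : Prop :=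
  eucl_util (setter_ideal P) y < eucl_util (setter_ideal P) x.

Definition Improvable (n d : nat) (P : 'M[R]_(n.+1, d)) (x : 'rV[R]_d) : Prop :=
  exists y : 'rV[R]_d, setter_pref P y x /\ maj_pref P y x.

Definition Manipulable (n d : nat) (P : 'M[R]_(n.+1, d)) : Prop :=
  forall x : 'rV[R]_d, x <> setter_ideal P -> Improvable P x.

Definition proj3 (d : nat) (a b c : 'I_d) (x : 'rV[R]_d) : 'rV[R]_3 :=
  \row_(k < 3) x 0 (nth a [:: a; b; c] k).

Definition coplanar4 (p : 'I_4 -> 'rV[R]_3) : Prop :=
  exists v : 'rV[R]_3, v != 0 /\
    exists c : R, forall k : 'I_4, \sum_(j < 3) v 0 j * p k 0 j = c.

Definition NonCoplanarity (n d : nat) (P : 'M[R]_(n.+1, d)) : Prop :=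
  forall a b c : 'I_d, a != b -> a != c -> b != c ->
  forall s : 'I_4 -> 'I_n.+1, injective s ->
    ~ coplanar4 (fun k => proj3 a b c (row (s k) P)).

(* Lebesgue-null subsets of R^(m*n) (identified with 'M_(m, n)):
   coverable by countably many closed boxes of arbitrarily small total volume *)
Definition in_box (m n : nat) (lo hi : 'M[R]_(m, n)) : set 'M[R]_(m, n) :=
  [set M | forall i j, lo i j <= M i j <= hi i j].

Definition box_vol (m n : nat) (lo hi : 'M[R]_(m, n)) : R :=
  \prod_(i < m) \prod_(j < n) (hi i j - lo i j).

Definition lebesgue_null (m n : nat) (S : set 'M[R]_(m, n)) : Prop :=
  forall eps : R, 0 < eps ->
  exists lo hi : nat -> 'M[R]_(m, n),
    (forall k i j, lo k i j <= hi k i j) /\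
    S `<=` \bigcup_k in_box (lo k) (hi k) /\
    (forall N : nat, \sum_(k < N) box_vol (lo k) (hi k) <= eps).

Definition full_measure (m n : nat) (S : set 'M[R]_(m, n)) : Prop :=
  lebesgue_null (~` S).

End Defs.

(* Main.v *)
(** (a) A move from [x] in the direction [u] benefits, if short enough, every player whose ideal
    point [z] satisfies [u . (z - x) > 0]. Project to three coordinates in which the setter's
    ideal point differs from [x], and put the origin at [x]. Some voter [i0] is linearly
    independent from the setter, since otherwise all points are collinear. The plane spanned by
    the two contains at most one further voter, so the normal [v], suitably signed, points to at
    least (n - 1) / 2 of the voters off the plane. Tilting [v] slightly inside the span wins [i0]
    and the setter as well.

    (b) Coplanarity of four points is the vanishing of a 3 x 3 determinant, which is affine in
    one entry with a smaller minor as its coefficient, and so on down to the constant 1. Where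
    the coefficient is nonzero the zero set is a countable union of Lipschitz graphs, hence null,
    and a change of that one entry leaves it. *)

Require Import Defs.
From HB Require Import structures.
From mathcomp Require Import all_boot all_order all_algebra.
From mathcomp Require Import all_classical all_reals.
From mathcomp Require Import topology normedtype matrix_normedtype.
From mathcomp Require Import zify ring lra.
Set Implicit Arguments. Unset Strict Implicit. Unset Printing Implicit Defensive.
Import Order.TTheory GRing.Theory Num.Theory numFieldNormedType.Exports.
Local Open Scope ring_scope.
Local Open Scope classical_set_scope.

(** * Null sets *)

Lemma ler_sum_subseq (R : numDomainType) (T : eqType) (s s' : seq T) (F : T -> R) :
  uniq s -> uniq s' -> {subset s <= s'} -> (forall t, 0 <= F t) ->
  \sum_(t <- s) F t <= \sum_(t <- s') F t.
Proof.
move=> us us' ss' F0.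
have sE : perm_eq s [seq t <- s' | t \in s].
  apply: uniq_perm => //; first exact: filter_uniq.
  by move=> t; rewrite mem_filter; case: (boolP (t \in s)) => // /ss' ->.
rewrite (perm_big _ sE) big_filter big_mkcond.
by apply: ler_sum => t _; case: ifP.
Qed.

Section NullSets.
Variables (R : realType) (m n : nat).
Local Notation mx := 'M[R]_(m.+1, n.+1).
Implicit Types (S : set mx) (M : mx).

Lemma box_vol_ge0 (lo hi : mx) : (forall i j, lo i j <= hi i j) -> 0 <= box_vol lo hi.
Proof.
by move=> le; apply: prodr_ge0 => i _; apply: prodr_ge0 => j _; rewrite subr_ge0.
Qed.

(** Relies on both dimensions being positive: for an empty matrix the volume would be the empty
    product 1. *)
Lemma box_vol_point M : box_vol M M = 0.
Proof. by rewrite /box_vol big_ord_recl big_ord_recl subrr !mul0r. Qed.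

(** Frees covers from being sequences. Numbers that encode no element of [T] receive the degenerate
    box at 0, which adds no volume. *)
Lemma lebesgue_null_countable S :
  (forall eps : R, 0 < eps -> exists (T : countType) (lo hi : T -> mx),
    [/\ forall t i j, lo t i j <= hi t i j,
        S `<=` \bigcup_t in_box (lo t) (hi t) &
        forall s : seq T, uniq s -> \sum_(t <- s) box_vol (lo t) (hi t) <= eps]) ->
  lebesgue_null S.
Proof.
move=> cover eps /cover[T [lo [hi [lohi sub vol]]]].
pose ext (f : T -> mx) k : mx := if pickle_inv k is Some t then f t else 0.
exists (ext lo), (ext hi); split; [|split].
- by move=> k i j; rewrite /ext; case: pickle_inv.
- move=> M /sub[t _ Mt]; exists (pickle t) => //.
  by rewrite /ext pickleK_inv.
- move=> N; apply: le_trans (vol (pmap pickle_inv (iota 0 N)) _); last first.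
    exact: pmap_uniq (@pickle_invK T) _ (iota_uniq _ _).
  rewrite big_pmap -(big_mkord predT (fun k => box_vol (ext lo k) (ext hi k))).
  rewrite /index_iota subn0; apply: ler_sum => k _; rewrite /ext.
  by case: pickle_inv => //=; rewrite box_vol_point.
Qed.

Lemma lebesgue_null_sub S S' : S `<=` S' -> lebesgue_null S' -> lebesgue_null S.
Proof.
move=> sub null eps /null[lo [hi [lohi [cov vol]]]]; exists lo, hi; split=> //.
by split=> //; apply: subset_trans cov.
Qed.

Lemma lebesgue_null0 : lebesgue_null (@set0 mx).
Proof.
move=> eps eps0; exists (fun=> 0), (fun=> 0); split=> //; split=> // N.
by rewrite big1 ?ltW// => k _; rewrite box_vol_point.
Qed.

(** The [k]-th set is covered within [eps / 2 ^+ k.+1], and the resulting double family of boxes is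
    indexed by pairs. *)
Lemma lebesgue_null_bigcup_nat (S : nat -> set mx) :
  (forall k, lebesgue_null (S k)) -> lebesgue_null (\bigcup_k S k).
Proof.
move=> null; apply: lebesgue_null_countable => eps eps0.
have e0 k : 0 < eps / 2 ^+ k.+1 by rewrite divr_gt0 ?exprn_gt0.
have /choice[lo lohi] k := null k _ (e0 k).
have /choice[hi {}lohi] := lohi.
exists (nat * nat)%type, (fun t => lo t.1 t.2), (fun t => hi t.1 t.2).
split=> [[k l] i j | M [k _ Mk] | s us] /=.
- by have [le _] := lohi k; apply: le.
- have [_ [cov _]] := lohi k.
  by have [l _ Ml] := cov _ Mk; exists (k, l).
(* [N] exceeds every index in [s], so [s] lies in an [N] by [N] square, which is summed row by
   row. *)
pose N := (\max_(t <- s) maxn t.1 t.2).+1.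
have vol0 k l : 0 <= box_vol (lo k l) (hi k l).
  by apply: box_vol_ge0; have [le _] := lohi k; apply: le.
have sN : {subset s <= [seq (k, l) | k <- iota 0 N, l <- iota 0 N]}.
  move=> [k l] kls; have le : (maxn k l <= \max_(t <- s) maxn t.1 t.2)%N.
    exact: (leq_bigmax_seq (F := fun t : nat * nat => maxn t.1 t.2) (k, l) kls).
  by apply: allpairs_f; rewrite mem_iota add0n ltnS (leq_trans _ le)// leq_max leqnn ?orbT.
apply: (le_trans (ler_sum_subseq us _ sN _)) => [|//|].
  by apply: allpairs_uniq; rewrite ?iota_uniq// => -[? ?] [].
rewrite big_allpairs /=.
have geo : \sum_(k <- iota 0 N) eps / 2 ^+ k.+1 = eps - eps / 2 ^+ N.
  elim: (N) => [|N' IH]; first by rewrite big_nil expr0 divr1 subrr.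
  rewrite -addn1 iotaD big_cat big_seq1 IH /= add0n addn1 exprS.
  have : 2 ^+ N' != 0 :> R by rewrite expf_neq0 ?pnatr_eq0.
  by move: (2 ^+ N') => x x0; field; rewrite x0.
apply: (@le_trans _ _ (\sum_(k <- iota 0 N) eps / 2 ^+ k.+1)).
  apply: ler_sum => k _; have [_ [_ vol]] := lohi k.
  by apply: le_trans (vol N); rewrite -(big_mkord predT (fun l => box_vol (lo k l) (hi k l)))
    /index_iota subn0.
by rewrite geo gerBl divr_ge0 ?exprn_ge0// ltW.
Qed.

Lemma lebesgue_null_bigcup (I : countType) (S : I -> set mx) :
  (forall i, lebesgue_null (S i)) -> lebesgue_null (\bigcup_i S i).
Proof.
move=> null; pose S' k := if pickle_inv k is Some i then S i else set0.
apply: (@lebesgue_null_sub _ (\bigcup_k S' k)).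
  by move=> M [i _ Mi]; exists (pickle i) => //; rewrite /S' pickleK_inv.
apply: lebesgue_null_bigcup_nat => k; rewrite /S'.
by case: pickle_inv => [i|]; [apply: null | apply: lebesgue_null0].
Qed.

Lemma lebesgue_nullU S S' :
  lebesgue_null S -> lebesgue_null S' -> lebesgue_null (S `|` S').
Proof.
move=> nS nS'; apply: (@lebesgue_null_sub _ (\bigcup_b if b then S else S')).
  by move=> M [SM|SM]; [exists true|exists false].
by apply: lebesgue_null_bigcup => -[].
Qed.

Lemma mem_subdivision (h y : R) (N : nat) : 0 <= y <= N.+1%:R * h ->
  exists k : 'I_N.+1, k%:R * h <= y <= k.+1%:R * h.
Proof.
elim: N => [|N IH] /andP[y0 yN].
  by exists ord0; rewrite mul0r y0.
have [yle|/ltW ley] := leP y (N.+1%:R * h).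
  have [|k kP] := IH; first by rewrite y0.
  by exists (widen_ord (leqnSn _) k).
by exists ord_max; rewrite /= ley.
Qed.

(* The cube [-K, K] is cut into N^D cells in all coordinates; among the cells that differ
   only in the coordinate (i0, j0) just the first one carries a box of positive volume,
   centred at a point of S lying over that cell. *)
Lemma lebesgue_null_lipschitz_graph S i0 j0 (K L : R) :
  (forall M, S M -> forall i j, `|M i j| <= K) ->
  (forall M M' h, S M -> S M' -> 0 <= h ->
     (forall i j, (i, j) != (i0, j0) -> `|M i j - M' i j| <= h) ->
     `|M i0 j0 - M' i0 j0| <= L * h) ->
  lebesgue_null S.
Proof.
wlog [K0 L0] : K L / 0 < K /\ 0 <= L.
  move=> wl SK SL; apply: (wl (`|K| + 1) `|L|).
  - by split=> //; rewrite ltr_wpDl.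
  - move=> M /SK MK i j; apply: le_trans (MK i j) _.
    by rewrite (le_trans (ler_norm K))// lerDl.
  - move=> M M' h SM SM' h0 hP; apply: le_trans (SL _ _ _ SM SM' h0 hP) _.
    by rewrite ler_wpM2r// ler_norm.
move=> SK SL; apply: lebesgue_null_countable => eps eps0.
(* [C] is the volume of the cube without its direction (i0, j0). The boxes have total volume
   [2 * L * h * C], and [N] is taken large enough to bring this below [eps]. *)
pose C := \prod_(ij : 'I_m.+1 * 'I_n.+1 | ij != (i0, j0)) (2 * K).
have C0 : 0 <= C by apply: prodr_ge0 => ij _; rewrite mulr_ge0// ltW.
have B0 : 0 <= 2 * L * (2 * K) * C / eps.
  by rewrite divr_ge0 ?(ltW eps0)// !mulr_ge0// ltW.
have := archi_boundP B0; set N := Num.Def.archi_bound _; move=> NP.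
pose h : R := 2 * K / N.+1%:R.
have NS0 : 0 < N.+1%:R :> R by [].
have h0 : 0 <= h by rewrite divr_ge0 ?mulr_ge0// ltW.
have hN : N.+1%:R * h = 2 * K by rewrite /h mulrC divfK// gt_eqF.
pose T := {ffun 'I_m.+1 * 'I_n.+1 -> 'I_N.+1}.
pose over (g : T) M := forall i j, (i, j) != (i0, j0) ->
  (g (i, j))%:R * h <= M i j + K <= (g (i, j)).+1%:R * h.
have /choice[c cP] (g : T) : exists c : R, forall M, S M -> over g M ->
    `|M i0 j0 - c| <= L * h.
  (* Two points of [S] over the same cell differ by at most [h] off (i0, j0), so any of them can be
     the centre; a cell without one gets the arbitrary centre 0. *)
  have [[M0 [SM0 oM0]]|no] := pselect (exists M0, S M0 /\ over g M0); last first.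
    by exists 0 => M SM oM; case: no; exists M.
  exists (M0 i0 j0) => M SM oM; apply: SL => // i j ij.
  have /andP[] := oM _ _ ij; have /andP[] := oM0 _ _ ij.
  by rewrite -natr1 mulrDl mul1r ler_norml => ? ? ? ?; lra.
pose r (g : T) : R := if g (i0, j0) == ord0 then L * h else 0.
have r0 g : 0 <= r g by rewrite /r; case: ifP => // _; rewrite mulr_ge0.
pose lo (g : T) : mx := \matrix_(i, j) if (i, j) == (i0, j0) then c g - r g
  else (g (i, j))%:R * h - K.
pose hi (g : T) : mx := \matrix_(i, j) if (i, j) == (i0, j0) then c g + r g
  else (g (i, j)).+1%:R * h - K.
pose F (ij : 'I_m.+1 * 'I_n.+1) (k : 'I_N.+1) : R :=
  if ij == (i0, j0) then (if k == ord0 then 2 * L * h else 0) else h.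
have volE g : box_vol (lo g) (hi g) = \prod_ij F ij (g ij).
  rewrite /box_vol pair_big /=; apply: eq_bigr => -[i j] _ /=; rewrite !mxE /F.
  case: ifP => [/eqP->|_]; last by rewrite -natr1; ring.
  by rewrite /r; case: ifP => _; ring.
have lohi g i j : lo g i j <= hi g i j.
  rewrite !mxE; case: ifP => _; first by have := r0 g; lra.
  by rewrite -natr1 mulrDl mul1r; lra.
exists T, lo, hi; split=> // [M SM|s us].
  have cell i j : exists k : 'I_N.+1, k%:R * h <= M i j + K <= k.+1%:R * h.
    apply: mem_subdivision; rewrite hN; have := SK _ SM i j.
    by rewrite ler_norml => /andP[? ?]; apply/andP; split; lra.
  have /choice[k kP] (ij : 'I_m.+1 * 'I_n.+1) := cell ij.1 ij.2.
  (* In the direction (i0, j0) the index is [ord0] whatever [M i0 j0] is, since only there does the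
     box have half-height [L * h]. *)
  pose g : T := [ffun ij => if ij == (i0, j0) then ord0 else k ij].
  have og : over g M by move=> i j ij; rewrite ffunE (negbTE ij); apply: (kP (i, j)).
  exists g => // i j; rewrite !mxE; case: ifP => [/eqP[-> ->]|/negbT ij].
    have := cP _ _ SM og; rewrite /r ffunE !eqxx ler_norml => /andP[? ?].
    by apply/andP; split; lra.
  by have /andP[? ?] := og _ _ ij; apply/andP; split; lra.
apply: (@le_trans _ _ (\sum_g box_vol (lo g) (hi g))).
  apply: ler_sum_subseq => //; rewrite ?index_enum_uniq//.
    by move=> t _; rewrite mem_index_enum.
  by move=> g; apply: box_vol_ge0; apply: lohi.
under eq_bigr do rewrite volE.
(* The sum over all cells of a product over coordinates becomes a product of sums: [2 * L * h] at
   (i0, j0) and [2 * K] at every other coordinate. *)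
rewrite -(bigA_distr_bigA F) (bigD1 (i0, j0))//=.
rewrite [X in _ * X](_ : _ = C); last first.
  apply: eq_bigr => ij ijP; rewrite /F (negbTE ijP) sumr_const card_ord.
  by rewrite -[h *+ _]mulr_natl hN.
rewrite /F eqxx -big_mkcond big_pred1_eq /h.
rewrite ltr_pdivrMr// in NP.
have NPS : 2 * L * (2 * K) * C <= N.+1%:R * eps.
  by rewrite -natr1 mulrDl mul1r; lra.
rewrite (_ : _ * C = 2 * L * (2 * K) * C / N.+1%:R); last by ring.
by rewrite ler_pdivrMr// [leRHS]mulrC.
Qed.

End NullSets.

(** * Polynomials that are affine in one entry *)

Lemma norm_coord_le (R : realFieldType) (m n : nat) (M : 'M[R]_(m, n)) i j :
  `|M i j| <= `|M|.
Proof.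
rewrite [leRHS]/Num.norm /= mx_normrE.
exact: (le_bigmax _ (fun ij : 'I_m * 'I_n => `|M ij.1 ij.2|) (i, j)).
Qed.

Section AffineInOneEntry.
Variables (R : realType) (m n : nat).
Local Notation mx := 'M[R]_(m.+1, n.+1).
Implicit Types (f g : mx -> R) (M : mx).

(* Lipschitz on every cube, with respect to the entries other than (i0, j0); with [h := 0] this
   contains the fact that [f] does not depend on the entry (i0, j0). *)
Definition lipschitz_off (i0 : 'I_m.+1) (j0 : 'I_n.+1) f : Prop :=
  forall K : R, exists2 L : R, 0 <= L & forall M M' (h : R), 0 <= h ->
    (forall i j, `|M i j| <= K) -> (forall i j, `|M' i j| <= K) ->
    (forall i j, (i, j) != (i0, j0) -> `|M i j - M' i j| <= h) ->
    `|f M - f M'| <= L * h.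

Lemma lipschitz_off_cst i0 j0 (c : R) : lipschitz_off i0 j0 (fun=> c).
Proof. by move=> K; exists 0 => // *; rewrite subrr normr0 mul0r. Qed.

Lemma lipschitz_off_coord i0 j0 i j :
  (i, j) != (i0, j0) -> lipschitz_off i0 j0 (fun M => M i j).
Proof. by move=> ij K; exists 1 => // M M' h _ _ _ off; rewrite mul1r off. Qed.

Lemma lipschitz_offD i0 j0 f g : lipschitz_off i0 j0 f -> lipschitz_off i0 j0 g ->
  lipschitz_off i0 j0 (fun M => f M + g M).
Proof.
move=> lf lg K; have [Lf Lf0 fP] := lf K; have [Lg Lg0 gP] := lg K.
exists (Lf + Lg) => [|M M' h h0 MK MK' off]; first exact: addr_ge0.
rewrite opprD addrACA mulrDl (le_trans (ler_normD _ _))//.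
by rewrite lerD ?fP ?gP.
Qed.

Lemma lipschitz_offN i0 j0 f : lipschitz_off i0 j0 f ->
  lipschitz_off i0 j0 (fun M => - f M).
Proof.
move=> lf K; have [L L0 fP] := lf K; exists L => // M M' h h0 MK MK' off.
by rewrite -opprD normrN fP.
Qed.

(** Comparison with the zero matrix; passing to [|K|] ensures that it lies in the cube. *)
Lemma lipschitz_off_bounded i0 j0 f (K : R) : lipschitz_off i0 j0 f ->
  exists2 B : R, 0 <= B & forall M, (forall i j, `|M i j| <= K) -> `|f M| <= B.
Proof.
move=> lf; have [L L0 fP] := lf `|K|.
exists (L * `|K| + `|f 0|) => [|M MK]; first by rewrite addr_ge0// mulr_ge0.
have MK' i j : `|M i j| <= `|K| by rewrite (le_trans (MK i j))// ler_norm.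
rewrite -lerBlDr (le_trans (lerB_dist _ _))// fP// => i j; first by rewrite mxE normr0.
by move=> _; rewrite mxE subr0.
Qed.

Lemma lipschitz_offM i0 j0 f g : lipschitz_off i0 j0 f -> lipschitz_off i0 j0 g ->
  lipschitz_off i0 j0 (fun M => f M * g M).
Proof.
move=> lf lg K; have [Lf Lf0 fP] := lf K; have [Lg Lg0 gP] := lg K.
have [Bf Bf0 fB] := lipschitz_off_bounded K lf.
have [Bg Bg0 gB] := lipschitz_off_bounded K lg.
exists (Lf * Bg + Bf * Lg) => [|M M' h h0 MK MK' off].
  by rewrite addr_ge0 ?mulr_ge0.
have -> : f M * g M - f M' * g M' = (f M - f M') * g M + f M' * (g M - g M') by ring.
rewrite (le_trans (ler_normD _ _))// !normrM mulrDl lerD//.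
  by rewrite mulrAC ler_pM// ?gB// fP.
by rewrite -mulrA ler_pM// ?fB// gP.
Qed.

Lemma lipschitz_off_indep i0 j0 f M M' : lipschitz_off i0 j0 f ->
  (forall i j, (i, j) != (i0, j0) -> M i j = M' i j) -> f M = f M'.
Proof.
move=> lf off; have [L _ fP] := lf (`|M| + `|M'|).
apply/eqP; rewrite -subr_eq0 -normr_le0 -(mulr0 L) fP// => i j.
- by rewrite (le_trans (norm_coord_le M i j))// lerDl.
- by rewrite (le_trans (norm_coord_le M' i j))// lerDr.
- by move=> /off ->; rewrite subrr normr0.
Qed.

(** Where [f] is nonzero the entry equals [- g / f]. This is Lipschitz in the other entries once [f]
    is bounded away from 0 and [M] is bounded, which holds on each of the countably many pieces
    [S k]. *)
Lemma lebesgue_null_affine i0 j0 f g :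
  lipschitz_off i0 j0 f -> lipschitz_off i0 j0 g ->
  lebesgue_null [set M | f M = 0] ->
  lebesgue_null [set M | f M * M i0 j0 + g M = 0].
Proof.
move=> lf lg null.
pose S (k : nat) := [set M | [/\ f M * M i0 j0 + g M = 0, k.+1%:R^-1 <= `|f M| &
  forall i j, `|M i j| <= k.+1%:R]].
apply: (@lebesgue_null_sub _ _ _ _ ([set M | f M = 0] `|` \bigcup_k S k)).
  move=> M /= M0; have [->|fM] := eqVneq (f M) 0; [by left|right].
  (* One bound for the sum makes [k] exceed both [|f M|^-1] and [|M|]. *)
  pose k := Num.Def.archi_bound (`|f M|^-1 + `|M|).
  have kP : `|f M|^-1 + `|M| < k%:R by apply: archi_boundP; rewrite addr_ge0 ?invr_ge0.
  have fM0 : 0 < `|f M| by rewrite normr_gt0.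
  exists k => //; split=> // [|i j].
    rewrite -[leRHS]invrK lef_pV2 ?posrE ?invr_gt0// -natr1.
    by have := normr_ge0 M; lra.
  rewrite (le_trans (norm_coord_le M i j))// -natr1.
  by have : 0 < `|f M|^-1; [rewrite invr_gt0 | lra].
apply: lebesgue_nullU => //; apply: lebesgue_null_bigcup => k.
have [Lf Lf0 fP] := lf k.+1%:R; have [Lg Lg0 gP] := lg k.+1%:R.
apply: (@lebesgue_null_lipschitz_graph _ _ _ _ i0 j0 k.+1%:R
  (k.+1%:R * (Lf * k.+1%:R + Lg))) => [M [_ _ //]|].
move=> M M' h [M0 fM MK] [M0' _ MK'] h0 off.
(* Difference of the two equations, arranged so that the difference of the entries is multiplied by
   [f M], whose inverse is at most [k.+1] in absolute value. *)
have E : f M * (M i0 j0 - M' i0 j0) = - ((f M - f M') * M' i0 j0 + (g M - g M')).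
  have -> : g M = - (f M * M i0 j0) by lra.
  have -> : g M' = - (f M' * M' i0 j0) by lra.
  by ring.
have k0 : 0 < k.+1%:R :> R by [].
rewrite -mulrA -ler_pdivrMl//.
apply: (@le_trans _ _ (`|f M| * `|M i0 j0 - M' i0 j0|)); first by rewrite ler_wpM2r.
rewrite -normrM E normrN (le_trans (ler_normD _ _))// [leRHS]mulrDl lerD ?gP//.
by rewrite normrM mulrAC ler_pM// fP.
Qed.

(** At a zero of the whole expression with [f M != 0], raising the entry (i0, j0) by [e / 2] leaves
    [f] and [g] unchanged and adds [f M * (e / 2)]. *)
Lemma dense_affine i0 j0 f g :
  lipschitz_off i0 j0 f -> lipschitz_off i0 j0 g ->
  dense [set M | f M != 0] ->
  dense [set M | f M * M i0 j0 + g M != 0].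
Proof.
move=> lf lg df O O0 oO; have [M [OM /= fM]] := df O O0 oO.
have [M0|] := eqVneq (f M * M i0 j0 + g M) 0; last by exists M.
have /nbhs_ballP[e /= e0 eO] : nbhs M O by apply: open_nbhs_nbhs.
pose M' : mx := \matrix_(i, j) if (i, j) == (i0, j0) then M i j + e / 2 else M i j.
have off i j : (i, j) != (i0, j0) -> M' i j = M i j by rewrite mxE => /negbTE->.
exists M'; split.
  apply: eO; split=> // i j; rewrite mxE; case: ifP => _; last exact: ballxx.
  rewrite /ball /= opprD addrA subrr sub0r normrN gtr0_norm ?divr_gt0//.
  by rewrite ltr_pdivrMr// ltr_pMr// ltr1n.
rewrite /= (lipschitz_off_indep lf off) (lipschitz_off_indep lg off) mxE eqxx.
by rewrite mulrDr addrAC M0 add0r mulf_neq0// mulf_neq0 ?gt_eqF// invr_gt0.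
Qed.

End AffineInOneEntry.

(** The sets are met one at a time: openness of [D i] keeps the intersection with [O] open, and
    density keeps it nonempty. *)
Lemma dense_open_forall (T : topologicalType) (I : finType) (D : I -> set T) :
  (forall i, open (D i)) -> (forall i, dense (D i)) ->
  dense [set x | forall i, D i x].
Proof.
move=> oD dD O O0 oO.
suff [x [Ox Dx]] : O `&` [set x | forall i, i \in enum I -> D i x] !=set0.
  by exists x; split=> // i; apply: Dx; rewrite mem_enum.
elim: (enum I) O O0 oO => [|i s IH] O O0 oO.
  by have [x Ox] := O0; exists x.
have [x [[Ox Dx] sx]] := IH (O `&` D i) (dD i _ O0 oO) (openI oO (oD i)).
by exists x; split=> // j; rewrite inE => /predU1P[->|/sx].
Qed.

(** * Coplanarity as a determinant *)

Lemma det_mx33 (R : comPzRingType) (A : 'M[R]_3) (a : nat -> nat -> R) :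
  (forall i j : 'I_3, A i j = a i j) ->
  \det A = a 2 0%N * (a 0%N 1%N * a 1%N 2 - a 0%N 2 * a 1%N 1%N)
         - a 2 1%N * (a 0%N 0%N * a 1%N 2 - a 0%N 2 * a 1%N 0%N)
         + a 2 2 * (a 0%N 0%N * a 1%N 1%N - a 0%N 1%N * a 1%N 0%N).
Proof.
move=> AE; rewrite (expand_det_row _ 0) !big_ord_recl big_ord0 /cofactor.
rewrite !(expand_det_row _ 0) !big_ord_recl !big_ord0 /cofactor !det_mx11 !mxE !AE /=.
by rewrite /bump /=; ring.
Qed.

Section Orientation.
Variables (R : realType) (N d : nat).
Implicit Types (M : 'M[R]_(N, d)) (a b c : 'I_d).

(** [orient1], [orient2] and [orient3] are the leading minors of the matrix whose rows are the edge
    vectors from point [k0], in the coordinates [a], [b], [c]. *)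
Definition orient1 a (k0 k1 : 'I_N) M : R := M k1 a - M k0 a.

Definition orient2 a b (k0 k1 k2 : 'I_N) M : R :=
  orient1 a k0 k1 M * orient1 b k0 k2 M - orient1 b k0 k1 M * orient1 a k0 k2 M.

Definition orient3 a b c (k0 k1 k2 k3 : 'I_N) M : R :=
  orient1 a k0 k3 M * orient2 b c k0 k1 k2 M
  - orient1 b k0 k3 M * orient2 a c k0 k1 k2 M
  + orient1 c k0 k3 M * orient2 a b k0 k1 k2 M.

(** A normal of a common plane is the same as a nonzero vector that annihilates the three edge
    vectors from the first point. *)
Lemma coplanar4_orient3 a b c (s : 'I_4 -> 'I_N) M :
  coplanar4 (fun k : 'I_4 => proj3 a b c (row (s k) M)) <->
  orient3 a b c (s (inord 0)) (s (inord 1)) (s (inord 2)) (s (inord 3)) M = 0.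
Proof.
pose p (k j : nat) := M (s (inord k)) (nth a [:: a; b; c] j).
pose A : 'M[R]_3 := \matrix_(j < 3, k < 3) (p k.+1 j - p 0%N j).
have pE (k : 'I_4) (j : 'I_3) : proj3 a b c (row (s k) M) 0 j = p k j.
  by rewrite !mxE /p inord_val.
have -> : orient3 a b c (s (inord 0)) (s (inord 1)) (s (inord 2)) (s (inord 3)) M = \det A.
  rewrite -det_tr (@det_mx33 _ _ (fun k j => p k.+1 j - p 0%N j)) => [|i j].
    by rewrite /orient3 /orient2 /orient1 /p /=; ring.
  by rewrite !mxE.
split=> [[v [v0 [e ve]]]|/eqP/det0P[v v0 vA]].
  have {}ve (k : 'I_4) : \sum_j v 0 j * p k j = e.
    by rewrite -(ve k); apply: eq_bigr => j _; rewrite pE.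
  apply/eqP/det0P; exists v => //; apply/rowP => k; rewrite !mxE.
  under eq_bigr do rewrite mxE mulrBr.
  have lek : (k.+1 < 4)%N by rewrite ltnS.
  by rewrite sumrB [X in X - _](ve (Ordinal lek)) [X in _ - X](ve ord0) subrr.
exists v; split=> //; exists (\sum_(j < 3) v 0 j * p 0%N j) => k.
under eq_bigr do rewrite pE.
case: k => -[|k] kl //=; have {}kl : (k < 3)%N by [].
apply/eqP; rewrite -subr_eq0 -sumrB; move/rowP: vA => /(_ (Ordinal kl)).
rewrite !mxE => vA; apply/eqP; rewrite -[RHS]vA.
by apply: eq_bigr => j _; rewrite mxE mulrBr.
Qed.

End Orientation.

Section OrientationContinuous.
Variables (R : realType) (m n : nat).
Local Notation mx := 'M[R]_(m, n).

Let continuous_sub (f g : mx -> R) :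
  continuous f -> continuous g -> continuous (fun M => f M - g M).
Proof. by move=> cf cg M; exact: (continuousB (cf M) (cg M)). Qed.

Let continuous_add (f g : mx -> R) :
  continuous f -> continuous g -> continuous (fun M => f M + g M).
Proof. by move=> cf cg M; exact: (continuousD (cf M) (cg M)). Qed.

Let continuous_mul (f g : mx -> R) :
  continuous f -> continuous g -> continuous (fun M => f M * g M).
Proof. by move=> cf cg M; exact: (continuousM (cf M) (cg M)). Qed.

Lemma orient3_continuous (a b c : 'I_n) (k0 k1 k2 k3 : 'I_m) :
  continuous (orient3 a b c k0 k1 k2 k3 : mx -> R).
Proof.
have c1 x k l : continuous (orient1 x k l : mx -> R).
  by apply: continuous_sub; exact: coord_continuous.
have c2 x y k l l' : continuous (orient2 x y k l l' : mx -> R).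
  by apply: continuous_sub; exact: continuous_mul.
by apply: continuous_add; [apply: continuous_sub|]; exact: continuous_mul.
Qed.

End OrientationContinuous.

Section GenericPosition.
Variables (R : realType) (m n : nat) (a b c : 'I_n.+1) (k0 k1 k2 k3 : 'I_m.+1).
Hypotheses (ab : a != b) (ac : a != c) (bc : b != c).
Hypotheses (k01 : k0 != k1) (k02 : k0 != k2) (k03 : k0 != k3).
Hypotheses (k12 : k1 != k2) (k13 : k1 != k3) (k23 : k2 != k3).
Local Notation mx := 'M[R]_(m.+1, n.+1).

Local Ltac lipschitz_off coord E :=
  repeat first [ apply: lipschitz_offD | apply: lipschitz_offN | apply: lipschitz_offM
               | apply: lipschitz_off_cst | apply: coord; by rewrite !E ?orbT ].

(* Closure of [Q] under the expansions of the determinant along the entries (k1, a), (k2, b),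
   (k3, c), each of which has the previous minor as its coefficient. *)
Lemma orient3_ind (Q : (mx -> R) -> Prop) :
  Q (fun=> 1) ->
  (forall i0 j0 f g, lipschitz_off i0 j0 f -> lipschitz_off i0 j0 g ->
     Q f -> Q (fun M => f M * M i0 j0 + g M)) ->
  Q (orient3 a b c k0 k1 k2 k3).
Proof.
move=> Q1 Qaff.
have E := (ab, ac, bc, eq_sym b a, eq_sym c a, eq_sym c b, k01, k02, k03, k12, k13, k23,
  eq_sym k3 k2, eq_sym k3 k1, eq_sym k2 k1, eq_sym k3 k0, eq_sym k2 k0, eq_sym k1 k0).
have coord i0 j0 i j : (i != i0) || (j != j0) -> lipschitz_off i0 j0 (fun M : mx => M i j).
  by move=> ij; apply: lipschitz_off_coord; rewrite xpair_eqE negb_and.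
have step i0 j0 f g f' : lipschitz_off i0 j0 f -> lipschitz_off i0 j0 g -> Q f ->
    (forall M, f' M = f M * M i0 j0 + g M) -> Q f'.
  by move=> lf lg Qf f'E; rewrite (funext f'E); apply: Qaff.
have Q2 : Q (orient1 a k0 k1).
  apply: (step k1 a (fun=> 1) (fun M => - M k0 a)) => // [||M].
  - by rewrite /orient1; lipschitz_off coord E.
  - by rewrite /orient1; lipschitz_off coord E.
  - by rewrite mul1r.
have Q3 : Q (orient2 a b k0 k1 k2).
  apply: (step k2 b (orient1 a k0 k1) (fun M => - ((M k1 a - M k0 a) * M k0 b) -
    (M k1 b - M k0 b) * (M k2 a - M k0 a))) => // [||M].
  - by rewrite /orient1; lipschitz_off coord E.
  - by rewrite /orient1; lipschitz_off coord E.
  - by rewrite /orient2 /orient1; ring.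
(* The remainder is spelled out in entries, none of which is (k3, c). *)
apply: (step k3 c (orient2 a b k0 k1 k2) (fun M =>
  - (((M k1 a - M k0 a) * (M k2 b - M k0 b) - (M k1 b - M k0 b) * (M k2 a - M k0 a))
     * M k0 c) +
  ((M k3 a - M k0 a) *
     ((M k1 b - M k0 b) * (M k2 c - M k0 c) - (M k1 c - M k0 c) * (M k2 b - M k0 b)) -
   (M k3 b - M k0 b) *
     ((M k1 a - M k0 a) * (M k2 c - M k0 c) - (M k1 c - M k0 c) * (M k2 a - M k0 a)))))
  => // [||M].
- by rewrite /orient2 /orient1; lipschitz_off coord E.
- by rewrite /orient2 /orient1; lipschitz_off coord E.
- by rewrite /orient3 /orient2 /orient1; ring.
Qed.

End GenericPosition.

(** * Genericity of Non-Coplanarity: null complement, openness and density *)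

Section NonCoplanarityGeneric.
Variables (R : realType) (n d : nat).
Local Notation profile := 'M[R]_(n.+1, d.+1).

(** Choices of coordinates and points form a finite type, so that Non-Coplanarity is a finite
    intersection and its complement a countable union. Repetitions are excluded separately by
    [valid]. *)
Let index := ('I_d.+1 * 'I_d.+1 * 'I_d.+1 * {ffun 'I_4 -> 'I_n.+1})%type.

Let valid (t : index) := [&& t.1.1.1 != t.1.1.2, t.1.1.1 != t.1.2, t.1.1.2 != t.1.2
  & injectiveb t.2].

Let det (t : index) : profile -> R :=
  orient3 t.1.1.1 t.1.1.2 t.1.2
    (t.2 (inord 0)) (t.2 (inord 1)) (t.2 (inord 2)) (t.2 (inord 3)).

Let NonCoplanarityE (P : profile) :
  NonCoplanarity P <-> forall t, valid t -> det t P != 0.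
Proof.
split=> [nc [[[a b] c] s] /and4P[/= ab ac bc /injectiveP s_inj]|nc a b c ab ac bc s s_inj].
  by apply/eqP => D0; apply: (nc a b c ab ac bc s s_inj); apply/coplanar4_orient3.
have sE : finfun s =1 s by move=> k; rewrite ffunE.
move/coplanar4_orient3/eqP; apply/negP.
have := nc (a, b, c, finfun s); rewrite /det /= !sE; apply.
by apply/and4P; split=> //; apply/injectiveP => k l; rewrite !sE => /s_inj.
Qed.

Let det_ind (Q : (profile -> R) -> Prop) t : valid t ->
  Q (fun=> 1) ->
  (forall i0 j0 f g, lipschitz_off i0 j0 f -> lipschitz_off i0 j0 g ->
     Q f -> Q (fun M => f M * M i0 j0 + g M)) ->
  Q (det t).
Proof.
case: t => [[[a b] c] s] /and4P[/= ab ac bc /injectiveP s_inj] Q1 Qaff.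
by apply: orient3_ind => //=; rewrite (inj_eq s_inj) -val_eqE /= !inordK.
Qed.

Lemma NonCoplanarity_full_measure :
  full_measure [set P : profile | NonCoplanarity P].
Proof.
apply: (@lebesgue_null_sub _ _ _ _
  (\bigcup_t [set P | valid t /\ det t P = 0])).
  move=> P /=; rewrite NonCoplanarityE => /existsNP[t /not_implyP[vt /negP]].
  by rewrite negbK => /eqP Dt; exists t.
apply: lebesgue_null_bigcup => t; have [vt|nvt] := boolP (valid t); last first.
  by apply: lebesgue_null_sub (@lebesgue_null0 _ _ _) => P [].
apply: (@lebesgue_null_sub _ _ _ _ [set P | det t P = 0]); first by move=> P [].
apply: (det_ind (Q := fun f => lebesgue_null [set P | f P = 0])) => //.
  by apply: lebesgue_null_sub (@lebesgue_null0 _ _ _) => P /= /eqP; rewrite oner_eq0.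
exact: lebesgue_null_affine.
Qed.

Let good t : set profile := [set P | valid t -> det t P != 0].

Let NonCoplanarity_good :
  [set P : profile | NonCoplanarity P] = [set P | forall t, good t P].
Proof. by apply/seteqP; split=> P /= /NonCoplanarityE. Qed.

Let good_open t : open (good t).
Proof.
rewrite /good; case: (valid t); last first.
  by have -> : [set P | false -> det t P != 0] = setT; [apply/seteqP | exact: openT].
have -> : [set P | true -> det t P != 0] = det t @^-1` [set~ 0].
  by apply/seteqP; split=> P /=; [move=> /(_ isT)/eqP | move=> /eqP].
apply: open_comp => [P _|]; first exact: orient3_continuous.
by apply: closed_openC; exact: closed_eq.
Qed.

Let good_dense t : dense (good t).
Proof.
rewrite /good; have [vt|nvt] := boolP (valid t); last first.
  by move=> O [P OP] _; exists P.
suff dt : dense [set P | det t P != 0] by move=> O O0 /(dt O O0)[P [OP DP]]; exists P; split.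
apply: (det_ind (Q := fun f => dense [set P | f P != 0])) => //.
  by move=> O [P OP] _; exists P; split=> //=; rewrite oner_eq0.
exact: dense_affine.
Qed.

Lemma NonCoplanarity_open : open [set P : profile | NonCoplanarity P].
Proof.
rewrite NonCoplanarity_good openE => P /= gP.
rewrite /interior /=; apply: (@filter_forall _ _ good (nbhs P)) => t.
exact: open_nbhs_nbhs.
Qed.

Lemma NonCoplanarity_dense : dense [set P : profile | NonCoplanarity P].
Proof. by rewrite NonCoplanarity_good; apply: dense_open_forall. Qed.

End NonCoplanarityGeneric.

(** * Manipulability *)

(** Serves twice: for the length of a move and for the tilt of its direction. *)
Lemma exists_small_perturbation (R : realFieldType) (I : eqType) (s : seq I) (f g : I -> R) :
  (forall i, i \in s -> 0 < f i) ->
  exists2 e : R, 0 < e & forall i, i \in s -> 0 < f i + e * g i.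
Proof.
move=> f0.
(* Claiming the inequality for all smaller [e'] as well lets the induction take a minimum. *)
suff [e e0 eP] : exists2 e : R, 0 < e &
    forall i, i \in s -> forall e', 0 < e' <= e -> 0 < f i + e' * g i.
  by exists e => // i /eP; apply; rewrite e0 lexx.
elim: s f0 => [|i s IH] f0; first by exists 1.
have [j js|e e0 eP] := IH; first by rewrite f0// inE js orbT.
have fi0 : 0 < f i by rewrite f0// mem_head.
pose ei := f i / (`|g i| + 1).
have gi0 : 0 < `|g i| + 1 by rewrite ltr_wpDl.
have ei0 : 0 < ei by rewrite divr_gt0.
exists (Num.min e ei) => [|j]; first by rewrite lt_min e0.
rewrite inE => /predU1P[->|js] e' /andP[e'0]; rewrite le_min => /andP[le_e le_ei].
  have : e' * (`|g i| + 1) <= f i by rewrite -ler_pdivlMr.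
  have : e' * - g i <= e' * `|g i|.
    by rewrite ler_pM2l// -normrN ler_norm.
  by rewrite mulrDr mulr1 mulrN; lra.
by apply: eP => //; rewrite e'0.
Qed.

Section Improvement.
Variables (R : realType) (n d : nat) (P : 'M[R]_(n.+1, d)) (x : 'rV[R]_d).

Definition dot (u z : 'rV[R]_d) : R := \sum_j u 0 j * z 0 j.

(** Expanding the square, the move lowers the squared distance to [p] by [t] times the quantity
    assumed positive. *)
Lemma eucl_util_move (p u : 'rV[R]_d) (t : R) :
  0 < t -> 0 < 2 * dot u (p - x) + t * - dot u u ->
  eucl_util p x < eucl_util p (x + t *: u).
Proof.
move=> t0 tP; rewrite /eucl_util !mulNr ltrN2 ltr_pM2l ?invr_gt0//.
have -> : sqdist (x + t *: u) p = sqdist x p - t * (2 * dot u (p - x) + t * - dot u u).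
  rewrite /sqdist /dot -sumrN !mulr_sumr -big_split /= mulr_sumr -sumrN -big_split /=.
  by apply: eq_bigr => j _; rewrite !mxE; ring.
by rewrite gtrBl mulr_gt0.
Qed.

Lemma Improvable_direction (u : 'rV[R]_d) :
  0 < dot u (setter_ideal P - x) ->
  (n < 2 * #|[pred i : 'I_n | (0 < dot u (voter_ideal P i - x))%R]|)%N ->
  Improvable P x.
Proof.
(* [None] stands for the setter, so that a single [t] serves the setter and the voters at once. *)
move=> uA uM; pose ideal (o : option 'I_n) :=
  if o is Some i then voter_ideal P i else setter_ideal P.
have [|t t0 tP] := @exists_small_perturbation R _
  [seq o <- enum {: option 'I_n} | 0 < dot u (ideal o - x)]
  (fun o => 2 * dot u (ideal o - x)) (fun=> - dot u u).
  by move=> o; rewrite mem_filter => /andP[o0 _]; rewrite mulr_gt0.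
have better o : 0 < dot u (ideal o - x) ->
    eucl_util (ideal o) x < eucl_util (ideal o) (x + t *: u).
  by move=> o0; apply: eucl_util_move => //; apply: tP; rewrite mem_filter o0 mem_enum.
exists (x + t *: u); split; first exact: (better None).
apply: leq_trans uM _; rewrite leq_mul2l /=; apply/subset_leq_card/fintype.subsetP => i.
by rewrite inE => i_better; apply/mem_set/(better (Some i)).
Qed.

End Improvement.

(** * Improving directions within three coordinates *)

Section ThreeCoordinates.
Variables (R : realType) (n d : nat) (P : 'M[R]_(n.+1, d)) (x : 'rV[R]_d).
Variables (a b c : 'I_d).
Hypotheses (ab : a != b) (ac : a != c) (bc : b != c).
Hypotheses (n_odd : odd n) (n_ge3 : (3 <= n)%N) (ncP : NonCoplanarity P).
Hypothesis xa : P ord_max a != x 0 a.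

Let voter (i : 'I_n) : 'I_n.+1 := widen_ord (leqnSn n) i.
Let Z i j := P i j - x 0 j.
Let dot3 (v : R * R * R) i := v.1.1 * Z i a + v.1.2 * Z i b + v.2 * Z i c.

(** With the origin at [x], Non-Coplanarity is applied to the planes through [x]; the constant of
    such a plane is the inner product of [v] with [x]. *)
Let no_plane (v : R * R * R) (s : 'I_4 -> 'I_n.+1) : v != (0, 0, 0) -> injective s ->
  exists k, dot3 v (s k) != 0.
Proof.
move=> v0 s_inj; apply/existsP; apply: contraT => /existsPn v_s.
case: (ncP ab ac bc s_inj); pose w : 'rV[R]_3 := \row_j nth 0 [:: v.1.1; v.1.2; v.2] j.
exists w; split.
  apply: contraNneq v0 => /rowP w0; move: (w0 0) (w0 1) (w0 2).
  by rewrite !mxE /=; case: v {v_s w w0} => [[? ?] ?] /= -> -> ->.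
exists (v.1.1 * x 0 a + v.1.2 * x 0 b + v.2 * x 0 c) => k.
rewrite !big_ord_recl big_ord0 !mxE /=.
by have /negPn/eqP := v_s k; rewrite /dot3 /Z => ?; lra.
Qed.

(** Cross product of the setter's vector with that of player [i]: a normal of the plane they span,
    zero exactly when they are dependent. *)
Let cross i : R * R * R :=
  (Z ord_max b * Z i c - Z ord_max c * Z i b,
   Z ord_max c * Z i a - Z ord_max a * Z i c,
   Z ord_max a * Z i b - Z ord_max b * Z i a).

Let exists_independent_voter : exists i, cross (voter i) != (0, 0, 0).
Proof.
apply/existsP; apply: contraT => /existsPn cr0.
have n4 : (4 <= n.+1)%N by [].
(* If all cross products vanish, their third components put every player on the plane with this
   normal, which is nonzero by [xa]. The first four rows give the contradiction; for [n = 3] the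
   last of them is the setter. *)
have [||k] := @no_plane (- Z ord_max b, Z ord_max a, 0) (widen_ord n4).
- by rewrite !xpair_eqE negb_and negb_and subr_eq0 xa orbT.
- by move=> k l /(congr1 val) /= kl; apply: val_inj.
move: (widen_ord n4 k) => l.
have [lt_ln|ge_ln] := ltnP l n.
  have := cr0 (Ordinal lt_ln); rewrite negbK => /eqP[_ _].
  have -> : voter (Ordinal lt_ln) = l by apply: val_inj.
  by rewrite /dot3 /= mul0r addr0 mulNr addrC => ->; rewrite eqxx.
have -> : l = ord_max by apply: val_inj; apply/eqP; rewrite eqn_leq ge_ln -ltnS ltn_ord.
by rewrite /dot3 /= mul0r addr0 mulNr mulrC addNr eqxx.
Qed.

(** Three voters on the plane would make four coplanar points together with the setter. *)
Let card_plane (v : R * R * R) : v != (0, 0, 0) -> dot3 v ord_max = 0 ->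
  (#|[pred i | (dot3 v (voter i) == 0)%R]| <= 2)%N.
Proof.
move=> v0 vA; rewrite leqNgt; apply/negP => /card_gt2P[i [j [k [[]]]]].
rewrite !inE => /eqP vi /eqP vj /eqP vk [ij jk ki].
pose s := [:: ord_max; voter i; voter j; voter k].
have s_uniq : uniq s.
  have ne l : (ord_max == voter l) = false.
    by rewrite -val_eqE /= gtn_eqF// ltn_ord.
  have inj l l' : (voter l == voter l') = (l == l') by [].
  by rewrite /= !inE !ne !inj (negbTE ij) (negbTE jk) eq_sym (negbTE ki).
have [||l] := @no_plane v (fun l => nth ord_max s l).
- by [].
- move=> l l' /eqP; rewrite nth_uniq ?ltn_ord// => /eqP; exact: val_inj.
- apply/negP; rewrite negbK.
  by case: l => -[|[|[|[|]]]] //= _; apply/eqP.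
Qed.

Let card_signs (f : 'I_n -> R) :
  (#|[pred i | (0 < f i)%R]| + #|[pred i | (f i < 0)%R]| + #|[pred i | (f i == 0)%R]|)%N = n.
Proof.
rewrite -!sum1_card !(big_mkcond (fun i => i \in _)) -!big_split /=.
rewrite -[RHS]card_ord -sum1_card; apply: eq_bigr => i _.
by rewrite !inE; case: (ltgtP (f i) 0).
Qed.

(* The vector [w] lies in the plane with normal [v] and has the same inner product |v|^2 with
   both of the vectors [Z ord_max] and [Z (voter i0)] that span it. *)
Lemma Improvable_three_coordinates : Improvable P x.
Proof.
have [i0 v0] := exists_independent_voter.
set v := cross (voter i0) in v0.
have vA : dot3 v ord_max = 0 by rewrite /dot3 /v /=; ring.
have vi0 : dot3 v (voter i0) = 0 by rewrite /dot3 /v /=; ring.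
pose zz i j := Z i a * Z j a + Z i b * Z j b + Z i c * Z j c.
pose al := zz (voter i0) (voter i0) - zz ord_max (voter i0).
(* [al] and [be] are Cramer's solution of the two equations [wA] and [wi0]: the Gram determinant of
   the spanning vectors equals [D] by Lagrange's identity. *)
pose be := zz ord_max ord_max - zz ord_max (voter i0).
pose w : R * R * R := (al * Z ord_max a + be * Z (voter i0) a,
  al * Z ord_max b + be * Z (voter i0) b, al * Z ord_max c + be * Z (voter i0) c).
pose D := v.1.1 ^+ 2 + v.1.2 ^+ 2 + v.2 ^+ 2.
have D0 : 0 < D.
  rewrite lt_neqAle !addr_ge0 ?sqr_ge0// andbT eq_sym.
  apply: contraNneq v0 => /eqP; rewrite /D !paddr_eq0 ?addr_ge0 ?sqr_ge0//.
  rewrite !sqrf_eq0 -!xpair_eqE; move/eqP => vE; apply/eqP.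
  by move: vE; rewrite -!surjective_pairing.
have wA : dot3 w ord_max = D by rewrite /dot3 /w /D /v /al /be /zz /=; ring.
have wi0 : dot3 w (voter i0) = D by rewrite /dot3 /w /D /v /al /be /zz /=; ring.
(* The sign [e] selects the larger open side of the plane. At most two voters lie on the plane and
   [n] is odd, so that side has at least (n - 1) / 2 voters; the successor counts [i0]. *)
have [e eP] : exists e : R, (n < 2 * #|[pred i | (0 < e * dot3 v (voter i))%R]|.+1)%N.
  have := card_plane v0 vA; have := card_signs (fun i => dot3 v (voter i)).
  set p := #|_|; set q := #|_|; set r := #|_| => pqr r2.
  have [le_qp|lt_pq] := leqP q p.
    exists 1; rewrite (@eq_card _ _ [pred i | 0 < dot3 v (voter i)]) => [|i]; last by rewrite !inE mul1r.
    by rewrite -/p; lia.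
  exists (-1); rewrite (@eq_card _ _ [pred i | dot3 v (voter i) < 0]) => [|i];
    last by rewrite !inE mulN1r oppr_gt0.
  by rewrite -/q; lia.
set S := [pred i | _] in eP.
(* The tilt [h] along [w] is small enough to keep all voters in [S]; [i0] and the setter, orthogonal
   to [v], gain [h * D]. *)
have [i|h h0 hP] := @exists_small_perturbation R _ (enum S)
  (fun i => e * dot3 v (voter i)) (fun i => dot3 w (voter i)).
  by rewrite mem_enum inE.
pose u : 'rV[R]_d := (e * v.1.1 + h * w.1.1) *: delta_mx 0 a +
  (e * v.1.2 + h * w.1.2) *: delta_mx 0 b + (e * v.2 + h * w.2) *: delta_mx 0 c.
have dotu i (y : 'rV_d) : (forall j, y 0 j = P i j) ->
    dot u (y - x) = e * dot3 v i + h * dot3 w i.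
  move=> yE; have dd j : \sum_k (delta_mx 0 j : 'rV[R]_d) 0 k * (y - x) 0 k = Z i j.
    rewrite (bigD1 j)//= big1 => [|k kj]; first by rewrite !mxE !eqxx mul1r addr0 yE.
    by rewrite !mxE (negbTE kj) mul0r.
  transitivity ((e * v.1.1 + h * w.1.1) * Z i a + (e * v.1.2 + h * w.1.2) * Z i b +
    (e * v.2 + h * w.2) * Z i c); last by rewrite /dot3; ring.
  rewrite -!dd !mulr_sumr -!big_split; apply: eq_bigr => k _.
  by rewrite /u !mxE /=; ring.
apply: (@Improvable_direction _ _ _ _ _ u).
  rewrite (dotu ord_max) => [|j]; last by rewrite mxE.
  by rewrite vA wA mulr0 add0r mulr_gt0.
apply: leq_trans eP _; rewrite leq_mul2l /=.
have i0S : i0 \notin S by rewrite inE vi0 mulr0 ltxx.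
have -> : #|S|.+1 = #|[predU1 i0 & S]| by rewrite cardU1 i0S.
apply/subset_leq_card/fintype.subsetP => i; rewrite !inE (dotu (voter i)) => [|j]; last by rewrite mxE.
case/predU1P => [->|iS]; first by rewrite vi0 wi0 mulr0 add0r mulr_gt0.
by apply: hP; rewrite mem_enum inE.
Qed.

End ThreeCoordinates.

Lemma NonCoplanarity_Manipulable (R : realType) (n d : nat) (P : 'M[R]_(n.+1, d)) :
  odd n -> (3 <= n)%N -> (3 <= d)%N -> NonCoplanarity P -> Manipulable P.
Proof.
move=> n_odd n_ge3 d_ge3 ncP x xA.
have [a xa] : exists a, P ord_max a != x 0 a.
  apply/existsP; apply: contraT => /existsPn eq_x; case: xA; apply/rowP => j.
  by rewrite mxE; apply/esym/eqP/negPn/eq_x.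
(* [a] separates [x] from the setter's ideal point; any two further coordinates complete the
   triple. *)
have [b [c [ab ac bc]]] : exists b c : 'I_d, [/\ a != b, a != c & b != c].
  have : (1 < #|predC1 a|)%N by rewrite cardC1 card_ord; case: (d) d_ge3 => [|[|]].
  case/card_gt1P => b [c [+ + bc]]; rewrite !inE => ba ca.
  by exists b, c; rewrite ![a == _]eq_sym.
exact: (Improvable_three_coordinates ab ac bc).
Qed.

Theorem theorem4 (R : realType) (n d : nat) (n_odd : odd n) (n_ge3 : (3 <= n)%N)
  (d_ge3 : (3 <= d)%N) :
  (forall P : 'M[R]_(n.+1, d), NonCoplanarity P -> Manipulable P) /\
  (full_measure [set P : 'M[R]_(n.+1, d) | NonCoplanarity P] /\
   open [set P : 'M[R]_(n.+1, d) | NonCoplanarity P] /\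
   dense [set P : 'M[R]_(n.+1, d) | NonCoplanarity P]).
Proof.
split; first by move=> P; exact: NonCoplanarity_Manipulable.
case: d d_ge3 => // d _; split; first exact: NonCoplanarity_full_measure.
split; [exact: NonCoplanarity_open | exact: NonCoplanarity_dense].
Qed.
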